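(* Let $0<q<1$, let $\check L$ and $\check R$ be the left, respectively right, $\mathcal{A}(\mathrm{S}^2_q)$-linear Hodge operators on the three dimensional exterior algebra $\Omega(\mathrm{S}^2_q)$ associated with a nondegenerate hermitian and real contraction with parameters $\alpha,\nu$ (see context). Then the Laplacians $\Box^L_{\mathrm{S}^2_q}f=-\check L\mathrm{d}\check L\mathrm{d}f$ and $\Box^R_{\mathrm{S}^2_q}f=-\check R\mathrm{d}\check R\mathrm{d}f$ satisfy, for all $f\in\mathcal{A}(\mathrm{S}^2_q)$, $$\Box^L_{\mathrm{S}^2_q}f=\{\alpha L_+L_-+q^2\alpha L_-L_++\nu L_0L_0\}\triangleright f,\qquad \Box^R_{\mathrm{S}^2_q}f=\{q^2\alpha R_+R_-+\alpha R_-R_++\nu R_0R_0\}\triangleright f,$$ they coincide on $\mathcal{A}(\mathrm{S}^2_q)$: $$\Box^{L}_{\mathrm{S}^2_q}f=\Box^{R}_{\mathrm{S}^2_q}f=(2q\alpha L_0+\nu L_0^2)\triangleright f ,$$ and on the basis elements $\phi_{0,J,l}=(c^Ja^{*J})\triangleleft E^l$ of $\mathcal{A}(\mathrm{S}^2_q)$, $J\in\mathbb{N}=\{0,1,2,\dots\}$, $l=0,\dots,2J$, they are diagonal: $$\Box^{L}_{\mathrm{S}^2_q}\phi_{0,J,l}=\Box^{R}_{\mathrm{S}^2_q}\phi_{0,J,l}=\big(2q\alpha[J][J+1]+\nu[J]^2[J+1]^2\big)\phi_{0,J,l}.$$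
   Context: Fix $0<q<1$; $[x]=\frac{q^x-q^{-x}}{q-q^{-1}}$. $\mathcal{A}=\mathcal{A}(\mathrm{SU}_q(2))$ is the unital complex $*$-algebra generated by $a,c$ with relations $ac=qca$, $ac^*=qc^*a$, $cc^*=c^*c$, $a^*a+c^*c=1=aa^*+q^2cc^*$. $\mathcal{U}_q(\mathfrak{su}(2))$ is the Hopf algebra generated by $K^{\pm1},E,F$ with $K^{\pm1}E=q^{\pm1}EK^{\pm1}$, $K^{\pm1}F=q^{\mp1}FK^{\pm1}$, $[E,F]=\frac{K^2-K^{-2}}{q-q^{-1}}$ and $\Delta K^{\pm1}=K^{\pm1}\otimes K^{\pm1}$, $\Delta E=E\otimes K+K^{-1}\otimes E$, $\Delta F=F\otimes K+K^{-1}\otimes F$. It acts on $\mathcal{A}$ on the left and on the right by commuting actions, with $h\triangleright(xy)=(h_{(1)}\triangleright x)(h_{(2)}\triangleright y)$ and $(xy)\triangleleft h=(x\triangleleft h_{(1)})(y\triangleleft h_{(2)})$. Left action: $K\triangleright a=q^{-1/2}a$, $K\triangleright c=q^{-1/2}c$, $K\triangleright a^*=q^{1/2}a^*$, $K\triangleright c^*=q^{1/2}c^*$; $F\triangleright a=F\triangleright c=0$, $F\triangleright a^*=c$, $F\triangleright c^*=-q^{-1}a$; $E\triangleright a=-qc^*$, $E\triangleright c=a^*$, $E\triangleright a^*=E\triangleright c^*=0$. Right action: $a\triangleleft K=q^{-1/2}a$, $c\triangleleft K=q^{1/2}c$, $a^*\triangleleft K=q^{1/2}a^*$, $c^*\triangleleft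 K=q^{-1/2}c^*$; $a\triangleleft F=c$, $c^*\triangleleft F=-q^{-1}a^*$, $c\triangleleft F=a^*\triangleleft F=0$; $c\triangleleft E=a$, $a^*\triangleleft E=-qc^*$, $a\triangleleft E=c^*\triangleleft E=0$. Put $\mathcal{L}_n=\{x\in\mathcal{A}:K\triangleright x=q^{n/2}x\}$ and $\mathcal{A}(\mathrm{S}^2_q)=\mathcal{L}_0$. Let $L_-=q^{1/2}FK^{-1}$, $L_+=q^{-1/2}EK^{-1}$, $L_z=\frac{K^{-2}-1}{q-q^{-1}}$, $L_0=\frac{q(K^2-1)+q^{-1}(K^{-2}-1)}{(q-q^{-1})^2}+FE$, and $R_\pm=L_\pm K^2$, $R_0=-L_0$. The $4D_+$ calculus: $\Omega^1(\mathrm{SU}_q(2))$ is the free left $\mathcal{A}$-module with basis $\omega_-,\omega_+,\omega_z,\omega_0$, $\mathrm{d}x=\sum_a(L_a\triangleright x)\omega_a$, and right module structure $\omega_-x=x\omega_-+q^{-1/2}(KE\triangleright x)\omega_0$, $\omega_+x=x\omega_++q^{-1/2}(FK\triangleright x)\omega_0$, $\omega_0x=(K^2\triangleright x)\omega_0$, $\omega_zx=(q-q^{-1})q^{1/2}(FK^{-1}\triangleright x)\omega_-+(K^{-2}\triangleright x)\omega_z+(q-q^{-1})q^{-1/2}(EK^{-1}\triangleright x)\omega_++(q-q^{-1})\big(\big(FE+q^{-1}\tfrac{K^{-2}-K^2}{(q-q^{-1})^2}\big)\triangleright x\big)\omega_0$. The (Woronowicz) exterior algebra $\Omega(\mathrm{SU}_q(2))$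 is generated by $\mathcal A$ and these 1-forms with relations $\omega_-\wedge\omega_-=\omega_+\wedge\omega_+=\omega_0\wedge\omega_0=0$; $\omega_z\wedge\omega_z=(q^2-q^{-2})\omega_+\wedge\omega_-$; $\omega_z\wedge\omega_\pm=-q^{\pm2}\omega_\pm\wedge\omega_z$; $\omega_\pm\wedge\omega_0=-\omega_0\wedge\omega_\pm$; $\omega_+\wedge\omega_-=-\omega_-\wedge\omega_+$; $\omega_z\wedge\omega_0+\omega_0\wedge\omega_z=(q-q^{-1})^2\omega_-\wedge\omega_+$. $\Omega^k$ is a free left $\mathcal A$-module of rank $1,4,6,4,1$, $k=0,\dots,4$, with basis the wedge products of distinct generators; $\mathrm d$ is extended as a graded derivation with $\mathrm{d}^2=0$. The exterior algebra of the sphere is the differential subalgebra $\Omega(\mathrm{S}^2_q)\subset\Omega(\mathrm{SU}_q(2))$ with $\Omega^0(\mathrm{S}^2_q)=\mathcal{L}_0$, $\Omega^1(\mathrm{S}^2_q)=\mathcal{L}_{-2}\omega_-\oplus\mathcal{L}_2\omega_+\oplus\mathcal{L}_0\omega_0=\omega_-\mathcal{L}_{-2}\oplus\omega_+\mathcal{L}_2\oplus\omega_0\mathcal{L}_0$, $\Omega^2(\mathrm{S}^2_q)=\mathcal{L}_{-2}\,\omega_-\wedge\omega_0\oplus\mathcal{L}_0\,\omega_-\wedge\omega_+\oplus\mathcal{L}_2\,\omega_0\wedge\omega_+$, $\Omega^3(\mathrm{S}^2_q)=\mathcal{L}_0\,\omega_-\wedge\omega_+\wedge\omega_0$. Hodge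 operators. A contraction map is a sesquilinear map (antilinear in the first entry) $\Gamma$ on the span of $\omega_-,\omega_+,\omega_z,\omega_0$. For the hermitian and real ones the only nonzero values are $\Gamma(\omega_-,\omega_-)=q^{-2}\Gamma(\omega_+,\omega_+)=\alpha$, $\Gamma(\omega_0,\omega_z)=\Gamma(\omega_z,\omega_0)=\epsilon$, $\Gamma(\omega_0,\omega_0)=\nu$, $\Gamma(\omega_z,\omega_z)=\gamma$, with real parameters satisfying $2\nu+(q^2-q^{-2})\epsilon=0$ and $2(\epsilon^2-\gamma\nu)+(q-q^{-1})^2(2q^2\alpha^2+\epsilon^2)=0$; nondegenerate means $\alpha\ne0$. Let $\check\mu=\check m\,\omega_-\wedge\omega_+\wedge\omega_0$, $\check m\in\mathbb{R}$. In degrees 1 and 3 (the only ones needed) the Hodge operators are, for $\phi\in\mathcal{L}_{-2}$, $\phi'\in\mathcal{L}_2$, $\phi''\in\mathcal{L}_0$: $\check L(\phi\omega_-)=\check m\alpha\,\phi\,\omega_-\wedge\omega_0$, $\check L(\phi'\omega_+)=\check m q^2\alpha\,\phi'\,\omega_0\wedge\omega_+$, $\check L(\phi''\omega_0)=-\check m\nu\,\phi''\,\omega_-\wedge\omega_+$, $\check L(\phi''\check\mu)=\phi''\check L(\check\mu)$; $\check R(\omega_-\phi)=\check m q^2\alpha\,\omega_-\wedge\omega_0\,\phi$, $\check R(\omega_+\phi')=\check m\alpha\,\omega_0\wedge\omega_+\,\phi'$, $\check R(\omega_0\phi'')=-\check m\nu\,\omega_-\wedge\omega_+\,\phi''$,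 $\check R(\check\mu\phi'')=\check R(\check\mu)\phi''$; and $\check m$ is normalized so that $\check L(\check\mu)=\check R(\check\mu)=1$. *)

(* Defs.v *)
From HB Require Import structures.
From mathcomp Require Import all_boot all_order all_algebra.
From mathcomp Require Import reals complex.

Set Implicit Arguments.
Unset Strict Implicit.
Unset Printing Implicit Defensive.

Import Order.TTheory GRing.Theory Num.Theory.

Local Open Scope ring_scope.
Local Open Scope complex_scope.

Section Scalars.
Variables (R : realType) (q : R).

Definition qhalf (n : int) : R[i] := (Num.sqrt q ^ n)%:C. (* q^(n/2) *)

Definition qlam : R[i] := (q - q^-1)%:C.

Definition qnum (n : int) : R := (q ^ n - q ^ (- n)) / (q - q^-1).

End Scalars.

Section QuantumGroup.
Variable R : realType.
Local Notation C := R[i].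

Definition is_star (A : algType C) (star : A -> A) : Prop :=
  [/\ forall x y, star (x + y) = star x + star y,
      forall (k : C) x, star (k *: x) = k^* *: star x,
      forall x y, star (x * y) = star y * star x
    & forall x, star (star x) = x].

Definition SUq2_rel (q : R) (A : algType C) (star : A -> A) (a c : A) : Prop :=
  [/\ a * c = q%:C *: (c * a),
      a * star c = q%:C *: (star c * a),
      c * star c = star c * c,
      star a * a + star c * c = 1
    & a * star a + (q ^+ 2)%:C *: (c * star c) = 1].

(* The *-algebra presented by the generators a, c and the relations above:
   SUq2_univ is the universal property of the presentation. *)
Record SUq2 (q : R) := {
  SUq2_alg :> algType C;
  SUq2_star : SUq2_alg -> SUq2_alg;
  SUq2_a : SUq2_alg;
  SUq2_c : SUq2_alg;
  SUq2_starP : is_star SUq2_star;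
  SUq2_relP : SUq2_rel q SUq2_star SUq2_a SUq2_c;
  SUq2_univ : forall (B : algType C) (sB : B -> B) (a' c' : B),
    is_star sB -> SUq2_rel q sB a' c' ->
    let good (f : {lrmorphism SUq2_alg -> B}) :=
      [/\ forall x, f (SUq2_star x) = sB (f x), f SUq2_a = a' & f SUq2_c = c']
    in exists2 f, good f & forall g, good g -> f =1 g
}.

Definition Uq_rel (q : R) (U : algType C) (K Ki E F : U) : Prop :=
  [/\ K * Ki = 1 /\ Ki * K = 1,
      K * E = q%:C *: (E * K) /\ Ki * E = (q^-1)%:C *: (E * Ki),
      K * F = (q^-1)%:C *: (F * K) /\ Ki * F = q%:C *: (F * Ki)
    & E * F - F * E = (qlam q)^-1 *: (K ^+ 2 - Ki ^+ 2)].

(* Likewise for the algebra U_q(su(2)), where UqKi stands for K^-1.  Its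
   coproduct enters through the Leibniz rules in Uq_actions. *)
Record Uqsu2 (q : R) := {
  Uq_alg :> algType C;
  UqK : Uq_alg;
  UqKi : Uq_alg;
  UqE : Uq_alg;
  UqF : Uq_alg;
  Uq_relP : Uq_rel q UqK UqKi UqE UqF;
  Uq_univ : forall (B : algType C) (K' Ki' E' F' : B),
    Uq_rel q K' Ki' E' F' ->
    let good (f : {lrmorphism Uq_alg -> B}) :=
      [/\ f UqK = K', f UqKi = Ki', f UqE = E' & f UqF = F']
    in exists2 f, good f & forall g, good g -> f =1 g
}.

Section CalculusGenerators.
Variables (q : R) (U : Uqsu2 q).
Local Notation K := (UqK U).
Local Notation Ki := (UqKi U).
Local Notation E := (UqE U).
Local Notation F := (UqF U).

Definition Lm : U := qhalf q 1 *: (F * Ki).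
Definition Lp : U := qhalf q (-1) *: (E * Ki).
Definition Lz : U := (qlam q)^-1 *: (Ki ^+ 2 - 1).
Definition L0 : U :=
  (qlam q ^+ 2)^-1 *:
    (q%:C *: (K ^+ 2 - 1) + (q^-1)%:C *: (Ki ^+ 2 - 1)) + F * E.

Definition Rm : U := Lm * K ^+ 2.
Definition Rp : U := Lp * K ^+ 2.
Definition R0 : U := - L0.

End CalculusGenerators.

Definition is_left_action (U A : algType C) (act : U -> A -> A) : Prop :=
  [/\ forall h (k : C) x y, act h (k *: x + y) = k *: act h x + act h y,
      forall (k : C) g h x, act (k *: g + h) x = k *: act g x + act h x,
      forall x, act 1 x = x
    & forall g h x, act (g * h) x = act g (act h x)].

Definition is_right_action (U A : algType C) (act : A -> U -> A) : Prop :=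
  [/\ forall h (k : C) x y, act (k *: x + y) h = k *: act x h + act y h,
      forall (k : C) g h x, act x (k *: g + h) = k *: act x g + act x h,
      forall x, act x 1 = x
    & forall g h x, act x (g * h) = act (act x g) h].

(* Since the coproduct is multiplicative, the module-algebra laws
   h |> xy = (h_1 |> x)(h_2 |> y) and xy <| h = (x <| h_1)(y <| h_2)
   are imposed on the generators h = K, K^-1, E, F only. *)
Record Uq_actions (q : R) (A : SUq2 q) (U : Uqsu2 q) := {
  lact : U -> A -> A;
  ract : A -> U -> A;
  lactP : is_left_action lact;
  ractP : is_right_action ract;
  lract_comm : forall g h x, ract (lact g x) h = lact g (ract x h);
  lactK_mul : forall x y,
    lact (UqK U) (x * y) = lact (UqK U) x * lact (UqK U) y;
  lactKi_mul : forall x y,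
    lact (UqKi U) (x * y) = lact (UqKi U) x * lact (UqKi U) y;
  lactE_mul : forall x y,
    lact (UqE U) (x * y) =
      lact (UqE U) x * lact (UqK U) y + lact (UqKi U) x * lact (UqE U) y;
  lactF_mul : forall x y,
    lact (UqF U) (x * y) =
      lact (UqF U) x * lact (UqK U) y + lact (UqKi U) x * lact (UqF U) y;
  ractK_mul : forall x y,
    ract (x * y) (UqK U) = ract x (UqK U) * ract y (UqK U);
  ractKi_mul : forall x y,
    ract (x * y) (UqKi U) = ract x (UqKi U) * ract y (UqKi U);
  ractE_mul : forall x y,
    ract (x * y) (UqE U) =
      ract x (UqE U) * ract y (UqK U) + ract x (UqKi U) * ract y (UqE U);
  ractF_mul : forall x y,
    ract (x * y) (UqF U) =
      ract x (UqF U) * ract y (UqK U) + ract x (UqKi U) * ract y (UqF U);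
  lactK_gen :
    let a := SUq2_a A in let c := SUq2_c A in let star := @SUq2_star q A in
    [/\ lact (UqK U) a = qhalf q (-1) *: a,
        lact (UqK U) c = qhalf q (-1) *: c,
        lact (UqK U) (star a) = qhalf q 1 *: star a
      & lact (UqK U) (star c) = qhalf q 1 *: star c];
  lactF_gen :
    let a := SUq2_a A in let c := SUq2_c A in let star := @SUq2_star q A in
    [/\ lact (UqF U) a = 0,
        lact (UqF U) c = 0,
        lact (UqF U) (star a) = c
      & lact (UqF U) (star c) = (- q^-1)%:C *: a];
  lactE_gen :
    let a := SUq2_a A in let c := SUq2_c A in let star := @SUq2_star q A in
    [/\ lact (UqE U) a = (- q)%:C *: star c,
        lact (UqE U) c = star a,
        lact (UqE U) (star a) = 0
      & lact (UqE U) (star c) = 0];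
  ractK_gen :
    let a := SUq2_a A in let c := SUq2_c A in let star := @SUq2_star q A in
    [/\ ract a (UqK U) = qhalf q (-1) *: a,
        ract c (UqK U) = qhalf q 1 *: c,
        ract (star a) (UqK U) = qhalf q 1 *: star a
      & ract (star c) (UqK U) = qhalf q (-1) *: star c];
  ractF_gen :
    let a := SUq2_a A in let c := SUq2_c A in let star := @SUq2_star q A in
    [/\ ract a (UqF U) = c,
        ract c (UqF U) = 0,
        ract (star a) (UqF U) = 0
      & ract (star c) (UqF U) = (- q^-1)%:C *: star a];
  ractE_gen :
    let a := SUq2_a A in let c := SUq2_c A in let star := @SUq2_star q A in
    [/\ ract a (UqE U) = 0,
        ract c (UqE U) = a,
        ract (star a) (UqE U) = (- q)%:C *: star c
      & ract (star c) (UqE U) = 0]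
}.

(* The line bundle L_n; L_0 is the algebra of the quantum sphere. *)
Definition line_bundle (q : R) (A : SUq2 q) (U : Uqsu2 q)
    (T : Uq_actions A U) (n : int) (x : A) : Prop :=
  lact T (UqK U) x = qhalf q n *: x.

Definition phi0 (q : R) (A : SUq2 q) (U : Uqsu2 q) (T : Uq_actions A U)
    (J l : nat) : A :=
  ract T (SUq2_c A ^+ J * SUq2_star (SUq2_a A) ^+ J) (UqE U ^+ l).

End QuantumGroup.

(* Positions of omega_-, omega_+, omega_z, omega_0 in the chosen ordering. *)
Definition im : 'I_4 := @Ordinal 4 0 isT.
Definition ip : 'I_4 := @Ordinal 4 1 isT.
Definition iz : 'I_4 := @Ordinal 4 2 isT.
Definition i0 : 'I_4 := @Ordinal 4 3 isT.

(* Wedge product of the omega_i, i in S, in increasing order of i. *)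
Definition wedge (R : realType) (Om : algType R[i]) (w : 'I_4 -> Om)
    (S : {set 'I_4}) : Om := \prod_(i in S) w i.

Definition is_form (R : realType) (A Om : algType R[i]) (emb : A -> Om)
    (w : 'I_4 -> Om) (k : nat) (eta : Om) : Prop :=
  exists x : {set 'I_4} -> A,
    eta = \sum_(S : {set 'I_4} | #|S| == k) emb (x S) * wedge w S.

(* The differential calculus on SU_q(2) and its exterior algebra: one algebra
   holds the forms of all degrees, its product is the wedge product, and A sits
   in degree 0 through emb. *)
Record calculus4D (R : realType) (q : R) (A : SUq2 q) (U : Uqsu2 q)
    (T : Uq_actions A U) := {
  forms :> algType R[i];
  emb : {lrmorphism A -> forms};
  om : 'I_4 -> forms;
  om_free : forall eta : forms, exists! x : {ffun {set 'I_4} -> A},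
    eta = \sum_(S : {set 'I_4}) emb (x S) * wedge om S;
  omm_mulr : forall x, om im * emb x =
    emb x * om im
    + qhalf q (-1) *: (emb (lact T (UqK U * UqE U) x) * om i0);
  omp_mulr : forall x, om ip * emb x =
    emb x * om ip
    + qhalf q (-1) *: (emb (lact T (UqF U * UqK U) x) * om i0);
  om0_mulr : forall x, om i0 * emb x = emb (lact T (UqK U ^+ 2) x) * om i0;
  omz_mulr : forall x, om iz * emb x =
    (qlam q * qhalf q 1) *: (emb (lact T (UqF U * UqKi U) x) * om im)
    + emb (lact T (UqKi U ^+ 2) x) * om iz
    + (qlam q * qhalf q (-1)) *: (emb (lact T (UqE U * UqKi U) x) * om ip)
    + qlam q *: (emb (lact T (UqF U * UqE U
         + ((q^-1)%:C / qlam q ^+ 2) *: (UqKi U ^+ 2 - UqK U ^+ 2)) x) * om i0);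
  om_sqr : [/\ om im * om im = 0, om ip * om ip = 0 & om i0 * om i0 = 0];
  omz_sqr : om iz * om iz = (q ^+ 2 - q ^- 2)%:C *: (om ip * om im);
  omz_p : om iz * om ip = (- q ^+ 2)%:C *: (om ip * om iz);
  omz_m : om iz * om im = (- q ^- 2)%:C *: (om im * om iz);
  omp_0 : om ip * om i0 = - (om i0 * om ip);
  omm_0 : om im * om i0 = - (om i0 * om im);
  omp_m : om ip * om im = - (om im * om ip);
  omz_0 : om iz * om i0 + om i0 * om iz = qlam q ^+ 2 *: (om im * om ip);
  dif : {linear forms -> forms};
  dif_fun : forall x : A, dif (emb x) =
    emb (lact T (Lm U) x) * om im + emb (lact T (Lp U) x) * om ip
    + emb (lact T (Lz U) x) * om iz + emb (lact T (L0 U) x) * om i0;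
  dif_form : forall k eta,
    is_form emb om k eta -> is_form emb om k.+1 (dif eta);
  dif_leibniz : forall k eta xi, is_form emb om k eta ->
    dif (eta * xi) = dif eta * xi + (-1) ^+ k * eta * dif xi;
  dif_dif : forall eta, dif (dif eta) = 0
}.

Section Sphere.
Variables (R : realType) (q : R) (A : SUq2 q) (U : Uqsu2 q).
Variables (T : Uq_actions A U) (Om : calculus4D T).
Local Notation I := (emb Om).
Local Notation w := (om Om).
Local Notation L := (line_bundle T).

(* Omega^k(S^2_q) inside the exterior algebra of SU_q(2). *)
Definition sphere_form (k : nat) (eta : Om) : Prop :=
  match k with
  | 0 => exists2 f, L 0 f & eta = I f
  | 1 => exists f g h, [/\ L (-2) f, L 2 g, L 0 h
           & eta = I f * w im + I g * w ip + I h * w i0]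
  | 2 => exists f g h, [/\ L (-2) f, L 0 g, L 2 h
           & eta = I f * (w im * w i0) + I g * (w im * w ip)
                   + I h * (w i0 * w ip)]
  | 3 => exists2 f, L 0 f & eta = I f * (w im * w ip * w i0)
  | _ => eta = 0
  end.

Definition in_span (v : Om) : Prop :=
  exists u : 'I_4 -> R[i], v = \sum_i u i *: w i.

(* Sesquilinear on the span of the omega_i, antilinear in the first entry. *)
Definition contraction (Gamma : Om -> Om -> R[i]) : Prop :=
  (forall (k : R[i]) u u' v, in_span u -> in_span u' -> in_span v ->
     Gamma (k *: u + u') v = k^* * Gamma u v + Gamma u' v) /\
  (forall (k : R[i]) u v v', in_span u -> in_span v -> in_span v' ->
     Gamma u (k *: v + v') = k * Gamma u v + Gamma u v').

(* Hermitian and real contractions with their parameters; rows and columns of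
   the matrix of values are ordered as omega_-, omega_+, omega_z, omega_0. *)
Definition hermitian_real_contraction (Gamma : Om -> Om -> R[i])
    (alpha eps nu gam : R) : Prop :=
  [/\ contraction Gamma,
      forall i j : 'I_4, Gamma (w i) (w j) =
        (nth 0 (nth [::] [:: [:: alpha; 0;                0;   0  ];
                             [:: 0;     q ^+ 2 * alpha;   0;   0  ];
                             [:: 0;     0;                gam; eps];
                             [:: 0;     0;                eps; nu ]] i) j)%:C,
      2 * nu + (q ^+ 2 - q ^- 2) * eps = 0
    & 2 * (eps ^+ 2 - gam * nu)
      + (q - q^-1) ^+ 2 * (2 * q ^+ 2 * alpha ^+ 2 + eps ^+ 2) = 0].

Definition vol (m : R) : Om := m%:C *: (w im * w ip * w i0).

(* Hodge operators are maps on all forms, constrained on sphere forms only. *)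
Record left_hodge (alpha nu m : R) (H : Om -> Om) : Prop := {
  left_hodge_form : forall k eta, (k <= 3)%N ->
    sphere_form k eta -> sphere_form (3 - k) (H eta);
  left_hodge_add : forall k eta xi, (k <= 3)%N ->
    sphere_form k eta -> sphere_form k xi -> H (eta + xi) = H eta + H xi;
  left_hodge_mul : forall k f eta, (k <= 3)%N ->
    L 0 f -> sphere_form k eta -> H (I f * eta) = I f * H eta;
  left_hodge_m : forall f, L (-2) f ->
    H (I f * w im) = (m * alpha)%:C *: (I f * (w im * w i0));
  left_hodge_p : forall f, L 2 f ->
    H (I f * w ip) = (m * q ^+ 2 * alpha)%:C *: (I f * (w i0 * w ip));
  left_hodge_0 : forall f, L 0 f ->
    H (I f * w i0) = (- (m * nu))%:C *: (I f * (w im * w ip));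
  left_hodge_3 : forall f, L 0 f -> H (I f * vol m) = I f * H (vol m);
  left_hodge_vol : H (vol m) = 1
}.

Record right_hodge (alpha nu m : R) (H : Om -> Om) : Prop := {
  right_hodge_form : forall k eta, (k <= 3)%N ->
    sphere_form k eta -> sphere_form (3 - k) (H eta);
  right_hodge_add : forall k eta xi, (k <= 3)%N ->
    sphere_form k eta -> sphere_form k xi -> H (eta + xi) = H eta + H xi;
  right_hodge_mul : forall k f eta, (k <= 3)%N ->
    L 0 f -> sphere_form k eta -> H (eta * I f) = H eta * I f;
  right_hodge_m : forall f, L (-2) f ->
    H (w im * I f) = (m * q ^+ 2 * alpha)%:C *: (w im * w i0 * I f);
  right_hodge_p : forall f, L 2 f ->
    H (w ip * I f) = (m * alpha)%:C *: (w i0 * w ip * I f);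
  right_hodge_0 : forall f, L 0 f ->
    H (w i0 * I f) = (- (m * nu))%:C *: (w im * w ip * I f);
  right_hodge_3 : forall f, L 0 f -> H (vol m * I f) = H (vol m) * I f;
  right_hodge_vol : H (vol m) = 1
}.

Definition laplacian (H : Om -> Om) (f : A) : Om :=
  - H (dif Om (H (dif Om (I f)))).

End Sphere.

(* Main.v *)
Require Import Defs.
From mathcomp Require Import all_boot all_order all_algebra.
From mathcomp Require Import reals complex.
From mathcomp Require Import ring.

(** The calculus is inner: with lam = q - q^-1 and
    omega = lam^-1 omega_z + (q + q^-1) lam^-2 omega_0, one has
    dx = omega x - x omega for every function x, and omega ^ omega = 0
    ([dif_inner], [omega_sqr]).  Since d^2 = 0, the anticommutator
    eta |-> omega ^ eta + eta ^ omega agrees with d on every form y dx, and each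
    generator omega_i is a sum of such forms, by the relations
    a^* a + c^* c = 1 = a a^* + q^2 c c^* and the commutation relations
    ([inner_form1_om]).  Hence
    d omega_- = q^-1 omega_- ^ omega_z,  d omega_+ = - q omega_+ ^ omega_z,
    d omega_0 = lam omega_- ^ omega_+.

    In the differential of a 2-form of the sphere the omega_z terms then cancel,
    because of the weight of its coefficient, and what remains is
    d(f omega_- ^ omega_0) = - (L_+ f) vol,
    d(f omega_0 ^ omega_+) = - (L_- f) vol,
    d(f omega_- ^ omega_+) = (L_0 f) vol,
    with vol = omega_- ^ omega_+ ^ omega_0
    ([dif_Im0], [dif_I0p], [dif_Imp]).  The left Laplacian follows from
    df = (L_- f) omega_- + (L_+ f) omega_+ + (L_0 f) omega_0.

    For the right Laplacian, moving the coefficients of df to the right replaces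
    L_0 by R_0 = - L_0: both corrections from omega_- and omega_+ are
    multiples of omega_0 and each equals L_0 f ([dif_right]).  After the Hodge
    operator the coefficients are moved back to the left
    ([wedge_m0_mulr], [wedge_0p_mulr], [wedge_mp_mulr]) and the same
    three differentials apply.

    On functions of weight 0 the operators EF and FE coincide with L_0, so that
    L_+ L_- = q L_0 and L_- L_+ = q^-1 L_0; this makes both Laplacians equal to
    2 q alpha L_0 + nu L_0^2.  Finally L_0 commutes with the right action, so its
    eigenvalue on (c^J a^*^J) <| E^l is that on c^J a^*^J, where EF
    gives [J] [J+1] ([L0_cJa'J]). *)

Set Implicit Arguments.
Unset Strict Implicit.
Unset Printing Implicit Defensive.

Import Order.TTheory GRing.Theory Num.Theory.
Local Open Scope ring_scope.
Local Open Scope complex_scope.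

(** * Scalars *)

Section Scalars.
Variables (R : realType) (q : R) (q_gt0 : 0 < q) (q_lt1 : q < 1).

(** All half-integral powers of q are written as integral powers of this root. *)
Definition qroot : R[i] := (Num.sqrt q)%:C.
Local Notation s := qroot.

Lemma qroot_neq0 : s != 0.
Proof. by rewrite /qroot fmorph_eq0 gt_eqF // sqrtr_gt0. Qed.

Lemma qhalfE n : qhalf q n = s ^ n.
Proof. by rewrite /qhalf /qroot fmorphXz. Qed.

Lemma qCE : q%:C = s ^+ 2.
Proof. by rewrite /qroot -rmorphXn /= sqr_sqrtr // ltW. Qed.

Lemma qlamE : qlam q = s ^+ 2 - s ^- 2.
Proof. by rewrite /qlam rmorphB fmorphV /= qCE. Qed.

Lemma q_lt_qV : q < q^-1.
Proof. by rewrite (lt_trans q_lt1) // invf_gt1. Qed.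

Lemma qlam_neq0 : qlam q != 0.
Proof. by rewrite /qlam fmorph_eq0 subr_eq0 lt_eqF // q_lt_qV. Qed.

Lemma qroot4_neq1 : s ^+ 4 - 1 != 0.
Proof.
have := qlam_neq0; apply: contraNneq => /eqP; rewrite subr_eq0 => /eqP s4.
have s0 := qroot_neq0.
suff -> : qlam q = (s ^+ 4 - 1) / s ^+ 2 by rewrite s4 subrr mul0r.
by rewrite qlamE; field.
Qed.

End Scalars.

(** Identities between rational functions of q^(1/2) whose denominators only
    involve q^(1/2) and q^2 - 1. *)
Ltac qfield q_gt0 q_lt1 :=
  rewrite ?qlamE //;
  move: (qroot_neq0 q_gt0) (qroot4_neq1 q_gt0 q_lt1);
  let r := fresh "r" in let r0 := fresh "r0" in let r4 := fresh "r4" in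
  move: (qroot _) => r r0 r4; field; rewrite ?expf_neq0 ?r0 ?r4 //;
  rewrite -?expr2 -?exprM /= ?r4 //.

(** * Weights and the action of the quantum enveloping algebra *)

Section Actions.
Variables (R : realType) (q : R) (q_gt0 : 0 < q) (q_lt1 : q < 1).
Variables (A : SUq2 q) (U : Uqsu2 q) (T : Uq_actions A U).
Local Notation s := (qroot q).
Local Notation K := (UqK U).
Local Notation Ki := (UqKi U).
Local Notation E := (UqE U).
Local Notation F := (UqF U).
Local Notation "h |> x" := (lact T h x) (at level 45, right associativity).
Local Notation lb := (line_bundle T).

Lemma lactM g h x : (g * h) |> x = g |> h |> x.
Proof. by case: (lactP T). Qed.

Lemma lact1 x : 1 |> x = x.
Proof. by case: (lactP T). Qed.

Lemma lactDr h x y : h |> (x + y) = h |> x + h |> y.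
Proof. by case: (lactP T) => H _ _ _; have := H h 1 x y; rewrite !scale1r. Qed.

Lemma lact0r h : h |> 0 = 0.
Proof. by apply: (addrI (h |> 0)); rewrite -lactDr !addr0. Qed.

Lemma lactZr h k x : h |> (k *: x) = k *: (h |> x).
Proof.
by case: (lactP T) => H _ _ _; have := H h k x 0; rewrite !addr0 lact0r addr0.
Qed.

Lemma lactDl g h x : (g + h) |> x = g |> x + h |> x.
Proof. by case: (lactP T) => _ H _ _; have := H 1 g h x; rewrite !scale1r. Qed.

Lemma lact0l x : 0 |> x = 0.
Proof. by apply: (addrI (0 |> x)); rewrite -lactDl !addr0. Qed.

Lemma lactZl k h x : (k *: h) |> x = k *: (h |> x).
Proof.
by case: (lactP T) => _ H _ _; have := H k h 0 x; rewrite addr0 lact0l addr0.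
Qed.

Lemma lactNl h x : (- h) |> x = - (h |> x).
Proof. by rewrite -scaleN1r lactZl scaleN1r. Qed.

Lemma lactNr h x : h |> (- x) = - (h |> x).
Proof. by rewrite -scaleN1r lactZr scaleN1r. Qed.

Definition lact_rules := (lactDl, lactZl, lactNl, lactM, lact1, lactDr, lactZr).

Lemma lactKKi x : K |> Ki |> x = x.
Proof. by case: (Uq_relP U) => [[e _] _ _ _]; rewrite -lactM e lact1. Qed.

Lemma lactKiK x : Ki |> K |> x = x.
Proof. by case: (Uq_relP U) => [[_ e] _ _ _]; rewrite -lactM e lact1. Qed.

Lemma lactKE x : K |> E |> x = s ^+ 2 *: (E |> K |> x).
Proof.
by case: (Uq_relP U) => [_ [e _] _ _]; rewrite -lactM e !lact_rules (qCE q_gt0).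
Qed.

Lemma lactKF x : K |> F |> x = s ^- 2 *: (F |> K |> x).
Proof.
case: (Uq_relP U) => [_ _ [e _] _].
by rewrite -lactM e !lact_rules fmorphV /= (qCE q_gt0).
Qed.

Lemma lactEF x :
  E |> F |> x = F |> E |> x + (qlam q)^-1 *: (K |> K |> x - Ki |> Ki |> x).
Proof.
case: (Uq_relP U) => [_ _ _ e]; apply/eqP; rewrite addrC -subr_eq; apply/eqP.
by rewrite -!lactM -[- _]lactNl -lactDl e !(lact_rules, expr2).
Qed.

Lemma lb_Ki n x : lb n x -> Ki |> x = s ^ (- n) *: x.
Proof.
rewrite /line_bundle qhalfE // => e.
have := congr1 (fun y => s ^ (- n) *: (Ki |> y)) e; rewrite lactKiK lactZr scalerA.
by rewrite -expfzDr ?qroot_neq0 // addNr expr0z scale1r => ->.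
Qed.

Lemma lb_E n x : lb n x -> lb (n + 2) (E |> x).
Proof.
rewrite /line_bundle !qhalfE // => e.
by rewrite lactKE e lactZr scalerA addrC expfzDr ?qroot_neq0.
Qed.

Lemma lb_F n x : lb n x -> lb (n - 2) (F |> x).
Proof.
rewrite /line_bundle !qhalfE // => e.
by rewrite lactKF e lactZr scalerA addrC expfzDr ?qroot_neq0.
Qed.

Lemma lb_D n x y : lb n x -> lb n y -> lb n (x + y).
Proof. by rewrite /line_bundle => ex ey; rewrite lactDr ex ey scalerDr. Qed.

Lemma lb_Z n k x : lb n x -> lb n (k *: x).
Proof. by rewrite /line_bundle => ex; rewrite lactZr ex !scalerA mulrC. Qed.

Lemma lb_0 n : lb n 0.
Proof. by rewrite /line_bundle lact0r scaler0. Qed.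

Lemma LmE n x : lb n x -> Lm U |> x = s ^ (1 - n) *: (F |> x).
Proof.
move=> nx; rewrite /Lm !lact_rules (lb_Ki nx) lactZr scalerA qhalfE.
by rewrite -expfzDr ?qroot_neq0.
Qed.

Lemma LpE n x : lb n x -> Lp U |> x = s ^ (- 1 - n) *: (E |> x).
Proof.
move=> nx; rewrite /Lp !lact_rules (lb_Ki nx) lactZr scalerA qhalfE.
by rewrite -expfzDr ?qroot_neq0.
Qed.

Lemma LzE n x : lb n x -> Lz U |> x = ((qlam q)^-1 * (s ^ (- (n + n)) - 1)) *: x.
Proof.
move=> nx; rewrite /Lz !(lact_rules, expr2) !(lb_Ki nx, lactZr) !scalerA.
rewrite -expfzDr ?qroot_neq0 // -opprD -[- x]scaleN1r -scalerDl scalerA.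
by [].
Qed.

Lemma L0E x : L0 U |> x = (qlam q ^+ 2)^-1 *:
    (s ^+ 2 *: (K |> K |> x - x) + s ^- 2 *: (Ki |> Ki |> x - x)) + F |> E |> x.
Proof.
by rewrite /L0 !(lact_rules, expr2) fmorphV /= (qCE q_gt0).
Qed.

Lemma lb0_K x : lb 0 x -> K |> x = x.
Proof. by rewrite /line_bundle qhalfE expr0z scale1r. Qed.

Lemma lb0_Ki x : lb 0 x -> Ki |> x = x.
Proof. by move/lb_Ki; rewrite oppr0 expr0z scale1r. Qed.

Lemma lb0_L0 x : lb 0 x -> L0 U |> x = F |> E |> x.
Proof.
by move=> x0; rewrite L0E !(lb0_K x0, lb0_Ki x0) subrr !(scaler0, add0r).
Qed.

(** On weight 0 the commutator [E, F] acts by zero. *)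
Lemma lb0_EF x : lb 0 x -> E |> F |> x = F |> E |> x.
Proof.
by move=> x0; rewrite lactEF !(lb0_K x0, lb0_Ki x0) subrr !(scaler0, addr0).
Qed.

Lemma lb_Lm n x : lb n x -> lb (n - 2) (Lm U |> x).
Proof. by move=> nx; rewrite (LmE nx); apply/lb_Z/lb_F. Qed.
Lemma lb_Lp n x : lb n x -> lb (n + 2) (Lp U |> x).
Proof. by move=> nx; rewrite (LpE nx); apply/lb_Z/lb_E. Qed.
Lemma lb_L0 x : lb 0 x -> lb 0 (L0 U |> x).
Proof. by move=> x0; rewrite lb0_L0 //; apply: (@lb_F 2); apply: (@lb_E 0). Qed.

Lemma lb0_LpLm x : lb 0 x -> Lp U |> Lm U |> x = s ^+ 2 *: (L0 U |> x).
Proof.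
move=> x0; rewrite (LpE (lb_Lm x0)) (LmE x0) lactZr scalerA lb0_EF // -lb0_L0 //.
Qed.

Lemma lb0_LmLp x : lb 0 x -> Lm U |> Lp U |> x = s ^- 2 *: (L0 U |> x).
Proof.
move=> x0; rewrite (LmE (lb_Lp x0)) (LpE x0) lactZr scalerA -lb0_L0 //.
by congr (_ *: _); rewrite -expfzDr ?qroot_neq0.
Qed.

(** * The spectrum of L_0 *)

Local Notation a := (SUq2_a A).
Local Notation c := (SUq2_c A).
Local Notation a' := (SUq2_star (SUq2_a A)).
Local Notation c' := (SUq2_star (SUq2_c A)).

Lemma starZ k (x : A) : SUq2_star (k *: x) = k^* *: SUq2_star x.
Proof. by case: (SUq2_starP A). Qed.
Lemma starM (x y : A) : SUq2_star (x * y) = SUq2_star y * SUq2_star x.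
Proof. by case: (SUq2_starP A). Qed.
Lemma starK (x : A) : SUq2_star (SUq2_star x) = x.
Proof. by case: (SUq2_starP A). Qed.

Lemma conj_real (x : R) : Num.conj x%:C = x%:C.
Proof. exact: conjc_real. Qed.

Lemma a'c : a' * c = s ^- 2 *: (c * a').
Proof.
case: (SUq2_relP A) => _ e _ _ _; have := congr1 (@SUq2_star _ _ A) e.
rewrite starZ !starM starK => ->; rewrite conj_real (qCE q_gt0) scalerA.
by rewrite mulVf ?scale1r // expf_neq0 // qroot_neq0.
Qed.

Lemma c'a' : c' * a' = s ^+ 2 *: (a' * c').
Proof.
case: (SUq2_relP A) => e _ _ _ _; have := congr1 (@SUq2_star _ _ A) e.
by rewrite starZ !starM => ->; rewrite conj_real (qCE q_gt0).
Qed.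

Lemma a'c_exp n : a' * c ^+ n = s ^- (2 * n) *: (c ^+ n * a').
Proof.
elim: n => [|n IH]; first by rewrite muln0 expr0 invr1 mulr1 mul1r scale1r.
rewrite (exprS c) mulrA a'c -scalerAl -(mulrA c a') IH -scalerAr mulrA scalerA.
by rewrite mulnS exprD -invfM.
Qed.

(** K 1 is a unit for the image of K, which is everything as K is invertible. *)
Lemma lactK_1 : K |> 1 = 1.
Proof.
by have := lactK_mul T 1 (Ki |> 1); rewrite mul1r !lactKKi mulr1.
Qed.

Lemma lactKi_1 : Ki |> 1 = 1.
Proof. by rewrite -{1}lactK_1 lactKiK. Qed.

Lemma lactE_1 : E |> 1 = 0.
Proof.
have := lactE_mul T 1 1; rewrite lactK_1 lactKi_1 !mulr1 mul1r.
by rewrite -{1}[E |> 1]addr0 => /addrI.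
Qed.

Lemma lactF_1 : F |> 1 = 0.
Proof.
have := lactF_mul T 1 1; rewrite lactK_1 lactKi_1 !mulr1 mul1r.
by rewrite -{1}[F |> 1]addr0 => /addrI.
Qed.

Lemma lb_M n p x y : lb n x -> lb p y -> lb (n + p) (x * y).
Proof.
rewrite /line_bundle !qhalfE // lactK_mul => -> ->.
by rewrite -scalerAl -scalerAr scalerA expfzDr ?qroot_neq0.
Qed.

Lemma lb_X n x k : lb n x -> lb (n *+ k) (x ^+ k).
Proof.
move=> nx; elim: k => [|k IH]; last by rewrite exprS mulrS; apply: lb_M.
by rewrite /line_bundle lactK_1 qhalfE // expr0z scale1r.
Qed.

Lemma lb_a : lb (-1) a.
Proof. by case: (lactK_gen T). Qed.
Lemma lb_c : lb (-1) c.
Proof. by case: (lactK_gen T). Qed.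
Lemma lb_a' : lb 1 a'.
Proof. by case: (lactK_gen T). Qed.
Lemma lb_c' : lb 1 c'.
Proof. by case: (lactK_gen T). Qed.

Lemma lactK_lb n x : lb n x -> K |> x = s ^ n *: x.
Proof. by rewrite /line_bundle qhalfE. Qed.

Lemma lactF_cX n : F |> c ^+ n = 0.
Proof.
have [_ Fc _ _] := lactF_gen T.
elim: n => [|n IH]; first exact: lactF_1.
by rewrite exprS lactF_mul Fc IH mul0r mulr0 addr0.
Qed.

Lemma lactE_a'X n : E |> a' ^+ n = 0.
Proof.
have [_ _ Ea' _] := lactE_gen T.
elim: n => [|n IH]; first exact: lactE_1.
by rewrite exprS lactE_mul Ea' IH mul0r mulr0 addr0.
Qed.

Definition qint (n : nat) : R[i] := (s ^+ (2 * n) - s ^- (2 * n)) / qlam q.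

Lemma qnumE (n : nat) : (qnum q n)%:C = qint n.
Proof.
rewrite /qnum /qint exprM -(qCE q_gt0) -exprVn -[n%:Z]/(n : int).
by rewrite -exprz_inv -!exprnP rmorphM rmorphB fmorphV !rmorphXn fmorphV exprVn.
Qed.

(** F behaves on powers of a^* as a q-derivation turning one factor a^* into c;
    moving c to the front past the a^* costs the powers of q. *)
Lemma lactF_a'X n : F |> a' ^+ n.+1 = (s ^- n * qint n.+1) *: (c * a' ^+ n).
Proof.
have [_ _ Fa' _] := lactF_gen T; have s0 := qroot_neq0 q_gt0.
elim: n => [|n IH].
  rewrite expr1 Fa' expr0 mulr1 /qint muln1 qlamE // divff -?qlamE ?qlam_neq0 //.
  by rewrite invr1 mul1r scale1r.
rewrite exprS lactF_mul Fa' IH (lb_Ki lb_a') (lactK_lb (lb_X n.+1 lb_a')).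
have e : a' * (c * a' ^+ n) = s ^- 2 *: (c * a' ^+ n.+1).
  by rewrite mulrA a'c -scalerAl -mulrA -exprS.
rewrite -scalerAl -!scalerAr e !scalerA -scalerDl; congr (_ *: _).
rewrite /qint natz -exprnP -[s ^ (-1)]/(s^-1) !mulnS !exprD.
by rewrite exprS; qfield q_gt0 q_lt1.
Qed.

Lemma lactE_cX n : E |> c ^+ n.+1 = (s ^- n * qint n.+1) *: (c ^+ n * a').
Proof.
have [_ Ec _ _] := lactE_gen T; have s0 := qroot_neq0 q_gt0.
elim: n => [|n IH].
  rewrite expr1 Ec expr0 mul1r /qint muln1 qlamE // divff -?qlamE ?qlam_neq0 //.
  by rewrite invr1 mul1r scale1r.
rewrite exprS lactE_mul Ec IH (lb_Ki lb_c) (lactK_lb (lb_X n.+1 lb_c)).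
rewrite -scalerAl -!scalerAr a'c_exp !scalerA (mulrA c) -(exprS c) -scalerDl.
congr (_ *: _).
have -> : s ^ (-1 *+ n.+1) = s ^- n.+1 by rewrite mulNrn natz -invr_expz.
rewrite /qint -[s ^ (- (-1))]/s !mulnS !exprD.
by rewrite exprS; qfield q_gt0 q_lt1.
Qed.

Lemma lb0_cJa'J J : lb 0 (c ^+ J * a' ^+ J).
Proof.
by have := lb_M (lb_X J lb_c) (lb_X J lb_a'); rewrite mulNrn addNr.
Qed.

Lemma ractZ k x h : ract T (k *: x) h = k *: ract T x h.
Proof.
case: (ractP T) => H _ _ _; have r0 : ract T 0 h = 0.
  by have := H h (-1) 0 0; rewrite scaler0 addr0 scaleN1r addNr.
by have := H h k x 0; rewrite !addr0 r0 addr0.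
Qed.

Lemma lb_ract n x h : lb n x -> lb n (ract T x h).
Proof. by rewrite /line_bundle -lract_comm => ->; rewrite ractZ. Qed.

(** F kills c and E kills a^*, so EF first turns c^J a^*^J into a multiple of
    c^(J+1) a^*^(J-1) and then back. *)
Lemma L0_cJa'J J :
  L0 U |> (c ^+ J * a' ^+ J) = (qint J * qint J.+1) *: (c ^+ J * a' ^+ J).
Proof.
rewrite lb0_L0; last exact: lb0_cJa'J.
rewrite -lb0_EF; last exact: lb0_cJa'J.
rewrite lactF_mul lactF_cX mul0r add0r.
case: J => [|n].
  by rewrite expr0 lactF_1 mulr0 lact0r /qint muln0 expr0 invr1 subrr !mul0r scale0r.
rewrite lactF_a'X (lb_Ki (lb_X _ lb_c)) -scalerAl -!scalerAr.
rewrite scalerA (mulrA _ c) -(exprSr c).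
rewrite lactZr lactE_mul lactE_a'X mulr0 addr0 lactE_cX (lactK_lb (lb_X _ lb_a')).
rewrite -scalerAl -scalerAr -mulrA -(exprS a') !scalerA; congr (_ *: _).
rewrite mulNrn !natz opprK -!exprnP.
rewrite exprS; have := expf_neq0 n (qroot_neq0 q_gt0); have := (qroot_neq0 q_gt0).
by move: (s ^+ n) (s) => u r r0 u0; field; rewrite u0 r0.
Qed.

Lemma L0_phi J l : L0 U |> phi0 T J l = (qint J * qint J.+1) *: phi0 T J l.
Proof.
by rewrite /phi0 -lract_comm L0_cJa'J ractZ. Qed.

End Actions.

(** * The calculus is inner *)

Section Calculus.
Variables (R : realType) (q : R) (q_gt0 : 0 < q) (q_lt1 : q < 1).
Variables (A : SUq2 q) (U : Uqsu2 q) (T : Uq_actions A U) (Om : calculus4D T).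
Local Notation s := (qroot q).
Local Notation lam := (qlam q).
Local Notation K := (UqK U).
Local Notation Ki := (UqKi U).
Local Notation E := (UqE U).
Local Notation F := (UqF U).
Local Notation "h |> x" := (lact T h x) (at level 45, right associativity).
Local Notation lb := (line_bundle T).
Local Notation a := (SUq2_a A).
Local Notation c := (SUq2_c A).
Local Notation a' := (SUq2_star (SUq2_a A)).
Local Notation c' := (SUq2_star (SUq2_c A)).
Local Notation I := (emb Om).
Local Notation d := (dif Om).
Local Notation wm := (om Om im).
Local Notation wp := (om Om ip).
Local Notation wz := (om Om iz).
Local Notation w0 := (om Om i0).

(** This is [1/2] [3/2], written without half-integral powers of q. *)
Definition L0half := (lam ^+ 2)^-1 * (s ^+ 4 + s ^- 4 - s ^+ 2 - s ^- 2).

Lemma L0half_neq0 : L0half != 0.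
Proof.
have s0 := qroot_neq0 q_gt0.
rewrite /L0half; have -> : s ^+ 4 + s ^- 4 - s ^+ 2 - s ^- 2 =
    ((s ^+ 2) ^+ 3 - 1) * (s ^+ 2 - 1) / s ^+ 4 by field.
have qn1 n : (s ^+ 2) ^+ n.+1 - 1 != 0.
  rewrite -(qCE q_gt0) -rmorphXn subr_eq0 -(rmorph1 (real_complex R)).
  by rewrite (inj_eq (@complexI R)) lt_eqF // exprn_ilt1 // ltW.
rewrite !mulf_neq0 ?invr_eq0 ?expf_neq0 ?qn1 ?qlam_neq0 ?(qn1 0%N) //.
Qed.

(** The four generators span two spin 1/2 representations, on which the Casimir
    element L_0 is the scalar [1/2] [3/2]. *)
Lemma L0_lowest x y : lb (-1) x -> E |> x = y -> F |> y = x ->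
  L0 U |> x = L0half *: x.
Proof.
move=> wx ex fy; rewrite (L0E q_gt0) ex fy !(lactK_lb wx, lb_Ki q_gt0 wx) !lactZr.
rewrite !(lactK_lb wx, lb_Ki q_gt0 wx) !scalerA -[- x]scaleN1r -!scalerDl.
rewrite !scalerA -scalerDl scalerA -{2}[x]scale1r -scalerDl; congr (_ *: _).
rewrite /L0half -[s ^ (-1)]/(s^-1) -[s ^ (- (-1))]/s.
by qfield q_gt0 q_lt1.
Qed.

Lemma L0_highest x : lb 1 x -> E |> x = 0 -> L0 U |> x = L0half *: x.
Proof.
move=> wx ex; rewrite (L0E q_gt0) ex lact0r addr0.
rewrite !(lactK_lb wx, lb_Ki q_gt0 wx) !lactZr.
rewrite !(lactK_lb wx, lb_Ki q_gt0 wx) !scalerA -[- x]scaleN1r -!scalerDl.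
rewrite !scalerA -scalerDl scalerA; congr (_ *: _).
rewrite /L0half -[s ^ 1]/s -[s ^ (- 1)]/(s^-1).
by qfield q_gt0 q_lt1.
Qed.

Lemma L0_gen : [/\ L0 U |> a = L0half *: a, L0 U |> c = L0half *: c,
  L0 U |> a' = L0half *: a' & L0 U |> c' = L0half *: c'].
Proof.
have [Ea Ec Ea' Ec'] := lactE_gen T; have [Fa Fc Fa' Fc'] := lactF_gen T.
split.
- apply: (L0_lowest (lb_a T) Ea); rewrite lactZr Fc' scalerA -rmorphM mulrNN.
  by rewrite mulfV ?gt_eqF // scale1r.
- exact: (L0_lowest (lb_c T) Ec).
- exact: (L0_highest (lb_a' T)).
- exact: (L0_highest (lb_c' T)).
Qed.

Lemma embZ k x : I (k *: x) = k *: I x.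
Proof. exact: linearZ. Qed.

Lemma is_form0 x : is_form I (om Om) 0 (I x).
Proof.
exists (fun _ => x).
rewrite (big_pred1 set0) => [|S]; last by rewrite cards_eq0.
by rewrite /wedge big_set0 mulr1.
Qed.

Lemma is_form1 i : is_form I (om Om) 1 (om Om i).
Proof.
exists (fun S => if S == [set i] then 1 else 0).
rewrite (bigD1 [set i]) /=; last by rewrite cards1.
rewrite eqxx rmorph1 mul1r /wedge big_set1 big1 ?addr0 // => S /andP[_ /negbTE ->].
by rewrite rmorph0 mul0r.
Qed.

Lemma dif0 x eta : d (I x * eta) = d (I x) * eta + I x * d eta.
Proof. by rewrite (dif_leibniz _ (is_form0 x)) expr0 mul1r. Qed.

Lemma dif1 i eta : d (om Om i * eta) = d (om Om i) * eta - om Om i * d eta.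
Proof. by rewrite (dif_leibniz _ (is_form1 i)) expr1 mulN1r mulNr. Qed.

(** The coefficient of omega_0 is forced by the K^2 term of L_0. *)
Definition omega : Om := lam^-1 *: wz + ((s ^+ 2 + s ^- 2) / lam ^+ 2) *: w0.

Lemma omega_sqr : omega * omega = 0.
Proof.
have [_ _ om_00] := om_sqr Om.
rewrite /omega mulrDl !mulrDr -!scalerAl -!scalerAr om_00 omz_sqr !scaler0 addr0.
rewrite -addrA [X in _ + (_ + X)]scalerA [X in _ + (_ + X *: _)]mulrC.
rewrite -[X in _ + (_ + X)]scalerA -!scalerDr.
rewrite omz_0 omp_m scalerN !scalerA.
rewrite scalerN scalerA -scaleNr -scalerDl rmorphB fmorphV rmorphXn /=.
rewrite (qCE q_gt0) scalerA.
rewrite -[RHS](scale0r (wm * wp)); congr (_ *: _).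
by qfield q_gt0 q_lt1.
Qed.

Lemma L0E_inner x : L0 U |> x =
  (F |> E |> x + (s ^- 2 / lam ^+ 2) *: (Ki |> Ki |> x - K |> K |> x))
  + ((s ^+ 2 + s ^- 2) / lam ^+ 2) *: (K |> K |> x - x).
Proof.
rewrite (L0E q_gt0) addrC -addrA; congr (_ + _).
have -> : Ki |> Ki |> x - K |> K |> x = (Ki |> Ki |> x - x) - (K |> K |> x - x).
  by rewrite opprB addrA subrK.
move: (_ - x) (_ - x) => r p.
rewrite scalerDr !scalerA scalerBr -addrA [RHS]addrC -scaleNr -!scalerDl.
by congr (_ *: _ + _ *: _); rewrite mulrC // mulrDl addrC addrK.
Qed.

Lemma dif_inner x : d (I x) = omega * I x - I x * omega.
Proof.
have l0 := qlam_neq0 q_gt0 q_lt1.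
rewrite /omega mulrDl mulrDr -!scalerAl -!scalerAr om0_mulr omz_mulr dif_fun.
rewrite L0E_inner /Lm /Lp /Lz !lact_rules !qhalfE fmorphV /= (qCE q_gt0).
set Y := (F |> E |> x + _ *: _).
move: Y => Y; rewrite !rmorphD /= !embZ !rmorphB /=.
rewrite !mulrDl -!scalerAl !mulrBl !scalerDr !scalerN opprD.
rewrite !scalerA !mulKf // mulVf // scale1r !addrA.
by rewrite [LHS](ACl (1*3*2*5*6*4*7)%AC).
Qed.

(** The anticommutator of omega with dx = [omega, x] is [omega^2, x]. *)
Lemma omega_dif x : omega * d (I x) + d (I x) * omega = 0.
Proof.
have e : omega * (omega * I x) = 0 by rewrite mulrA omega_sqr mul0r.
rewrite dif_inner mulrBr mulrBl -!mulrA omega_sqr mulr0 subr0 e sub0r.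
by rewrite addNr.
Qed.

Definition inner_form1 (eta : Om) := d eta = omega * eta + eta * omega.

(** As d^2 = 0, d(y dx) = dy ^ dx = omega y dx - y omega dx, and omega
    anticommutes with dx. *)
Lemma inner_form1_ydx y x : inner_form1 (I y * d (I x)).
Proof.
rewrite /inner_form1 dif0 dif_dif mulr0 addr0 {1}dif_inner mulrBl -!mulrA.
congr (_ + _); apply/eqP; rewrite eq_sym -addr_eq0 -mulrDr addrC omega_dif.
by rewrite mulr0.
Qed.

Lemma inner_form1_D eta xi : inner_form1 eta -> inner_form1 xi ->
  inner_form1 (eta + xi).
Proof.
by rewrite /inner_form1 linearD /= => -> ->; rewrite addrACA -mulrDr -mulrDl.
Qed.

Lemma inner_form1_Z k eta : inner_form1 eta -> inner_form1 (k *: eta).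
Proof.
by rewrite /inner_form1 linearZ /= => ->; rewrite scalerDr -scalerAr -scalerAl.
Qed.

Lemma dif_eigen x k : Lz U |> x = k *: x -> L0 U |> x = L0half *: x ->
  d (I x) = I (Lm U |> x) * wm + I (Lp U |> x) * wp
    + I x * (k *: wz + L0half *: w0).
Proof.
move=> ez e0; rewrite dif_fun ez e0 !embZ mulrDr -!scalerAl -!scalerAr addrA.
by [].
Qed.

(** A sum y1 dx1 + y2 dx2 where x1 and x2 are generators of the same weight, so
    that L_z and L_0 act on them by common scalars. *)
Lemma inner_form1_pair x1 x2 y1 y2 k :
  Lz U |> x1 = k *: x1 -> Lz U |> x2 = k *: x2 ->
  L0 U |> x1 = L0half *: x1 -> L0 U |> x2 = L0half *: x2 ->
  inner_form1 (I (y1 * (Lm U |> x1) + y2 * (Lm U |> x2)) * wm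
    + I (y1 * (Lp U |> x1) + y2 * (Lp U |> x2)) * wp
    + I (y1 * x1 + y2 * x2) * (k *: wz + L0half *: w0)).
Proof.
move=> z1 z2 l1 l2.
have := inner_form1_D (inner_form1_ydx y1 x1) (inner_form1_ydx y2 x2).
rewrite (dif_eigen z1 l1) (dif_eigen z2 l2); move: (k *: wz + _) => v.
rewrite !rmorphD !rmorphM /= !mulrDr !mulrDl !mulrA !addrA => H.
by rewrite [X in inner_form1 X](ACl (1*3*5*2*4*6)%AC).
Qed.

Definition Lzlow := lam^-1 * (s ^+ 2 - 1).
Definition Lzhigh := lam^-1 * (s ^- 2 - 1).

Lemma Lz_lowest x : lb (-1) x -> Lz U |> x = Lzlow *: x.
Proof. by move=> wx; rewrite (LzE q_gt0 wx). Qed.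

Lemma Lz_highest x : lb 1 x -> Lz U |> x = Lzhigh *: x.
Proof. by move=> wx; rewrite (LzE q_gt0 wx). Qed.

Lemma Lm_gen : [/\ Lm U |> a = 0, Lm U |> c = 0, Lm U |> a' = c
  & Lm U |> c' = - s ^- 2 *: a].
Proof.
have [Fa Fc Fa' Fc'] := lactF_gen T.
rewrite !(LmE q_gt0 (lb_a T), LmE q_gt0 (lb_c T),
  LmE q_gt0 (lb_a' T), LmE q_gt0 (lb_c' T)).
rewrite Fa Fc Fa' Fc' !scaler0 subrr expr0z !scale1r.
by rewrite rmorphN fmorphV /= (qCE q_gt0).
Qed.

Lemma Lp_gen : [/\ Lp U |> a = - s ^+ 2 *: c', Lp U |> c = a', Lp U |> a' = 0
  & Lp U |> c' = 0].
Proof.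
have [Ea Ec Ea' Ec'] := lactE_gen T.
rewrite !(LpE q_gt0 (lb_a T), LpE q_gt0 (lb_c T),
  LpE q_gt0 (lb_a' T), LpE q_gt0 (lb_c' T)).
rewrite Ea Ec Ea' Ec' !scaler0 subrr expr0z !scale1r.
by rewrite rmorphN /= (qCE q_gt0).
Qed.

(** One has omega_- = c^* da^* - q a^* dc^* and omega_+ = a dc - q c da,
    while a^* da + c^* dc and a da^* + q^2 c dc^* are two independent
    combinations of omega_z and omega_0. *)
Lemma inner_form1_om : [/\ inner_form1 wm, inner_form1 wp, inner_form1 wz
  & inner_form1 w0].
Proof.
have [La Lc La' Lc'] := L0_gen.
have [ma mc ma' mc'] := Lm_gen; have [pa pc pa' pc'] := Lp_gen.
have [za zc] := (Lz_lowest (lb_a T), Lz_lowest (lb_c T)).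
have [za' zc'] := (Lz_highest (lb_a' T), Lz_highest (lb_c' T)).
have [ac ac' cc' one one'] := SUq2_relP A.
rewrite (qCE q_gt0) in ac, ac'; rewrite rmorphXn /= (qCE q_gt0) in one'.
have s0 := qroot_neq0 q_gt0; have l0 := qlam_neq0 q_gt0 q_lt1.
have im : inner_form1 wm.
  have := inner_form1_pair c' (- s ^+ 2 *: a') za' zc' La' Lc'.
  rewrite ma' mc' pa' pc' !mulr0 addr0 rmorph0 mul0r addr0.
  rewrite -!scalerAl -scalerAr scalerA mulrNN mulfV ?expf_neq0 // scale1r.
  rewrite [c' * c + _]addrC one (c'a' q_gt0) scaleNr subrr rmorph0 mul0r addr0.
  by rewrite rmorph1 mul1r.
have ip : inner_form1 wp.
  have := inner_form1_pair a (- s ^+ 2 *: c) zc za Lc La.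
  rewrite mc ma pc pa !mulr0 addr0 rmorph0 mul0r add0r.
  rewrite -!scalerAl -scalerAr scalerA mulrNN -expr2 one'.
  by rewrite ac scaleNr subrr rmorph0 mul0r addr0 rmorph1 mul1r.
have low : inner_form1 (Lzlow *: wz + L0half *: w0).
  have := inner_form1_pair a' c' za zc La Lc.
  rewrite ma mc pa pc !mulr0 addr0 rmorph0 mul0r add0r -scalerAr.
  by rewrite (c'a' q_gt0) scaleNr addNr rmorph0 mul0r add0r one rmorph1 mul1r.
have high : inner_form1 (Lzhigh *: wz + L0half *: w0).
  have := inner_form1_pair a (s ^+ 2 ^+ 2 *: c) za' zc' La' Lc'.
  rewrite ma' mc' pa' pc' !mulr0 addr0 rmorph0 mul0r addr0.
  rewrite -!scalerAl -scalerAr scalerA ac -scalerDl.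
  have -> : s ^+ 2 + s ^+ 2 ^+ 2 * - s ^- 2 = 0 by field.
  by rewrite scale0r rmorph0 mul0r add0r one' rmorph1 mul1r.
have iz : inner_form1 wz.
  have := inner_form1_D low (inner_form1_Z (-1) high).
  rewrite scaleN1r opprD addrACA subrr addr0 -scalerBl.
  have -> : Lzlow - Lzhigh = 1; last by rewrite scale1r.
  by rewrite /Lzlow /Lzhigh; qfield q_gt0 q_lt1.
split=> //.
have := inner_form1_Z (L0half^-1) (inner_form1_D low (inner_form1_Z (- Lzlow) iz)).
rewrite addrAC scaleNr subrr add0r scalerA mulVf ?L0half_neq0 //.
by rewrite scale1r.
Qed.

Lemma dif_omm : d wm = s ^- 2 *: (wm * wz).
Proof.
have [-> _ _ _] := inner_form1_om.
rewrite /omega mulrDl mulrDr -!scalerAl -!scalerAr omz_m omm_0.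
rewrite scalerN addrACA subrr addr0.
rewrite scalerA -scalerDl; congr (_ *: _).
rewrite rmorphN fmorphV rmorphXn /= (qCE q_gt0).
by qfield q_gt0 q_lt1.
Qed.

Lemma dif_omp : d wp = - s ^+ 2 *: (wp * wz).
Proof.
have [_ -> _ _] := inner_form1_om.
rewrite /omega mulrDl mulrDr -!scalerAl -!scalerAr omz_p omp_0.
rewrite scalerN addrACA subrr addr0.
rewrite scalerA -scalerDl; congr (_ *: _).
rewrite rmorphN rmorphXn /= (qCE q_gt0).
by qfield q_gt0 q_lt1.
Qed.

Lemma dif_om0 : d w0 = lam *: (wm * wp).
Proof.
have [_ _ _ ->] := inner_form1_om; have [_ _ om_00] := om_sqr Om.
rewrite /omega mulrDl mulrDr -!scalerAl -!scalerAr om_00 !scaler0 !addr0.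
rewrite -scalerDr omz_0 scalerA; congr (_ *: _).
by rewrite expr2 mulKf ?qlam_neq0.
Qed.

End Calculus.

(** * Differentials of forms on the sphere *)

Section Sphere.
Variables (R : realType) (q : R) (q_gt0 : 0 < q) (q_lt1 : q < 1).
Variables (A : SUq2 q) (U : Uqsu2 q) (T : Uq_actions A U) (Om : calculus4D T).
Local Notation s := (qroot q).
Local Notation lam := (qlam q).
Local Notation K := (UqK U).
Local Notation Ki := (UqKi U).
Local Notation E := (UqE U).
Local Notation F := (UqF U).
Local Notation "h |> x" := (lact T h x) (at level 45, right associativity).
Local Notation lb := (line_bundle T).
Local Notation I := (emb Om).
Local Notation d := (dif Om).
Local Notation wm := (om Om im).
Local Notation wp := (om Om ip).
Local Notation wz := (om Om iz).
Local Notation w0 := (om Om i0).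
Local Notation vol0 := (wm * wp * w0).

Lemma om_mm : wm * wm = 0. Proof. by case: (om_sqr Om). Qed.
Lemma om_pp : wp * wp = 0. Proof. by case: (om_sqr Om). Qed.
Lemma om_00 : w0 * w0 = 0. Proof. by case: (om_sqr Om). Qed.

Lemma wedge_m_m0 : wm * (wm * w0) = 0. Proof. by rewrite mulrA om_mm mul0r. Qed.
Lemma wedge_p_m0 : wp * (wm * w0) = - vol0. Proof. by rewrite mulrA omp_m mulNr. Qed.
Lemma wedge_z_m0 : wz * (wm * w0) = - s ^- 4 *: (wm * (wz * w0)).
Proof.
rewrite mulrA omz_m -scalerAl -mulrA rmorphN fmorphV rmorphXn /= (qCE q_gt0).
by rewrite -exprM.
Qed.
Lemma wedge_0_m0 : w0 * (wm * w0) = 0.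
Proof. by rewrite omm_0 mulrN mulrA om_00 mul0r oppr0. Qed.

Lemma wedge_0pE : w0 * wp = - (wp * w0). Proof. by rewrite omp_0 opprK. Qed.

Lemma wedge_m_0p : wm * (w0 * wp) = - vol0.
Proof. by rewrite wedge_0pE mulrN mulrA. Qed.
Lemma wedge_p_0p : wp * (w0 * wp) = 0.
Proof. by rewrite wedge_0pE mulrN mulrA om_pp mul0r oppr0. Qed.
Lemma wedge_z_0p : wz * (w0 * wp) = s ^+ 4 *: (w0 * (wp * wz)).
Proof.
have e : wz * w0 = lam ^+ 2 *: (wm * wp) - w0 * wz by rewrite -omz_0 addrK.
rewrite mulrA e mulrBl -scalerAl -(mulrA wm) om_pp mulr0 scaler0 sub0r -mulrA omz_p.
by rewrite -scalerAr -scaleNr -rmorphN opprK rmorphXn /= (qCE q_gt0) -exprM.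
Qed.
Lemma wedge_0_0p : w0 * (w0 * wp) = 0. Proof. by rewrite mulrA om_00 mul0r. Qed.

Lemma wedge_m_mp : wm * (wm * wp) = 0. Proof. by rewrite mulrA om_mm mul0r. Qed.
Lemma wedge_p_mp : wp * (wm * wp) = 0.
Proof. by rewrite mulrA omp_m mulNr -mulrA om_pp mulr0 oppr0. Qed.
Lemma wedge_0_mp : w0 * (wm * wp) = vol0.
Proof.
have -> : w0 * (wm * wp) = - (wm * w0) * wp by rewrite omm_0 opprK mulrA.
by rewrite mulNr -(mulrA wm w0) wedge_m_0p opprK.
Qed.

Lemma dif_om_m0 : d (wm * w0) = s ^- 2 *: (wm * (wz * w0)).
Proof.
rewrite dif1 (dif_omm q_gt0 q_lt1) (dif_om0 q_gt0 q_lt1).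
by rewrite -scalerAr wedge_m_mp scaler0 subr0 -scalerAl mulrA.
Qed.

Lemma dif_om_0p : d (w0 * wp) = s ^+ 2 *: (w0 * (wp * wz)).
Proof.
rewrite dif1 (dif_omp q_gt0 q_lt1) (dif_om0 q_gt0 q_lt1).
by rewrite -scalerAl -mulrA om_pp mulr0 scaler0 sub0r -scalerAr scaleNr opprK.
Qed.

Lemma dif_om_mp : d (wm * wp) = 0.
Proof.
rewrite dif1 (dif_omp q_gt0 q_lt1) (dif_omm q_gt0 q_lt1).
rewrite -scalerAl -mulrA omz_p -!scalerAr scalerA scaleNr opprK -scalerDl.
rewrite -[RHS](scale0r (wm * (wp * wz))); congr (_ *: _).
by rewrite rmorphN rmorphXn /= (qCE q_gt0); qfield q_gt0 q_lt1.
Qed.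

Lemma lb0_Lz f : lb 0 f -> Lz U |> f = 0.
Proof. by move=> f0; rewrite (LzE q_gt0 f0) subrr mulr0 scale0r. Qed.

(** On weight -2 the term (L_z f) omega_z cancels against d(omega_- ^ omega_0). *)
Lemma dif_Im0 f : lb (-2) f -> d (I f * (wm * w0)) = - (I (Lp U |> f) * vol0).
Proof.
move=> fm; rewrite dif0 dif_fun !mulrDl -!(mulrA (I _)).
rewrite wedge_m_m0 wedge_p_m0 wedge_0_m0 wedge_z_m0 dif_om_m0.
rewrite !mulr0 add0r addr0 mulrN -addrA (LzE q_gt0 fm) embZ -scalerAl -!scalerAr.
rewrite scalerA -scalerDl -[RHS]addr0 -(scale0r (I f * (wm * (wz * w0)))).
congr (_ + _ *: _); rewrite -[s ^ _]/(s ^+ 4).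
by qfield q_gt0 q_lt1.
Qed.

(** On weight 2 the term (L_z f) omega_z cancels against d(omega_0 ^ omega_+). *)
Lemma dif_I0p f : lb 2 f -> d (I f * (w0 * wp)) = - (I (Lm U |> f) * vol0).
Proof.
move=> fm; rewrite dif0 dif_fun !mulrDl -!(mulrA (I _)).
rewrite wedge_m_0p wedge_p_0p wedge_0_0p wedge_z_0p dif_om_0p.
rewrite !mulr0 !addr0 mulrN -addrA (LzE q_gt0 fm) embZ -scalerAl -!scalerAr.
rewrite scalerA -scalerDl -[RHS]addr0 -(scale0r (I f * (w0 * (wp * wz)))).
congr (_ + _ *: _); rewrite -[s ^ _]/(s ^- 4).
by qfield q_gt0 q_lt1.
Qed.

(** Here L_z f = 0 and omega_- ^ omega_+ is closed. *)
Lemma dif_Imp f : lb 0 f -> d (I f * (wm * wp)) = I (L0 U |> f) * vol0.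
Proof.
move=> f0; rewrite dif0 dif_fun !mulrDl -!(mulrA (I _)).
rewrite wedge_m_mp wedge_p_mp wedge_0_mp dif_om_mp.
by rewrite lb0_Lz // rmorph0 mul0r !mulr0 !add0r addr0.
Qed.

(** The omega_0 correction in omega_- f is killed by the factor omega_0. *)
Lemma wedge_m0_mulr n f : lb n f -> wm * w0 * I f = s ^ (n + n) *: (I f * (wm * w0)).
Proof.
move=> fn; rewrite -mulrA om0_mulr lactM !(lactK_lb fn, lactZr) scalerA.
rewrite -expfzDr ?qroot_neq0 // embZ -scalerAl -scalerAr (mulrA wm (I f)) omm_mulr.
by rewrite mulrDl -scalerAl -!mulrA om_00 mulr0 scaler0 addr0.
Qed.

Lemma wedge_0p_mulr n f : lb n f -> w0 * wp * I f = s ^ (n + n) *: (I f * (w0 * wp)).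
Proof.
move=> fn; rewrite -mulrA omp_mulr mulrDr -scalerAr !mulrA !om0_mulr.
rewrite -!(mulrA (I _)) om_00 mulr0 scaler0 addr0.
rewrite expr2 lactM !(lactK_lb fn, lactZr) scalerA.
by rewrite -expfzDr ?qroot_neq0 // embZ -scalerAl.
Qed.

(** Unlike the other two basis 2-forms, omega_- ^ omega_+ does not commute with
    functions up to a twist: each factor contributes an omega_0 correction. *)
Lemma wedge_mp_mulr f : lb 0 f -> wm * wp * I f = I f * (wm * wp)
  + s ^+ 2 *: (I (Lp U |> f) * (w0 * wp)) + s ^- 2 *: (I (Lm U |> f) * (wm * w0)).
Proof.
move=> f0; have s0 := qroot_neq0 q_gt0.
have f1 := lb_F q_gt0 f0; have f2 := lb_E q_gt0 f0.
rewrite -mulrA omp_mulr mulrDr -scalerAr !mulrA !omm_mulr !mulrDl -!scalerAl -!mulrA.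
rewrite om_00 mulr0 scaler0 addr0 !lactM (lb0_K f0) (lactK_lb f2)
  (LpE q_gt0 f0) (LmE q_gt0 f0).
rewrite !embZ -!scalerAl !scalerA !qhalfE //.
congr (_ + _ *: _ + _ *: _).
- by rewrite -[s ^ (0 + 2)]/(s ^+ 2) -[s ^ _]/(s^-1) mulrC.
- by rewrite -[s ^ (1 - 0)]/s -[s ^ _]/(s^-1); field.
Qed.

Lemma vol0_mulr f : lb 0 f -> vol0 * I f = I f * vol0.
Proof.
have e1 : w0 * wp * w0 = 0 by rewrite wedge_0pE mulNr -mulrA om_00 mulr0 oppr0.
have e2 : wm * w0 * w0 = 0 by rewrite -mulrA om_00 mulr0.
move=> f0; rewrite -mulrA om0_mulr expr2 lactM !(lb0_K f0) mulrA wedge_mp_mulr //.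
rewrite !mulrDl -!scalerAl -!(mulrA (I _)) e1 e2.
by rewrite !(mulr0, scaler0) !addr0.
Qed.

Lemma dif_left f : lb 0 f ->
  d (I f) = I (Lm U |> f) * wm + I (Lp U |> f) * wp + I (L0 U |> f) * w0.
Proof. by move=> f0; rewrite dif_fun lb0_Lz // rmorph0 mul0r addr0. Qed.

(** The omega_0 corrections of omega_- (L_- f) and omega_+ (L_+ f) are both
    (L_0 f) omega_0, so the coefficient of omega_0 becomes L_0 f - 2 L_0 f. *)
Lemma dif_right f : lb 0 f ->
  d (I f) = wm * I (Lm U |> f) + wp * I (Lp U |> f) + w0 * I (- (L0 U |> f)).
Proof.
move=> f0; have s0 := qroot_neq0 q_gt0.
have f1 := lb_Lm q_gt0 f0; have f2 := lb_Lp q_gt0 f0; have f3 := lb_L0 q_gt0 f0.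
have e1 : s^-1 *: (K |> E |> Lm U |> f) = L0 U |> f.
  have := lb0_LpLm q_gt0 f0; rewrite (LpE q_gt0 f1) => /(congr1 (fun x => s ^- 2 *: x)).
  rewrite !scalerA mulVf ?expf_neq0 // scale1r => <-.
  rewrite (lb0_K (lb_E q_gt0 f1)); congr (_ *: _).
  by rewrite -[s ^ _]/s; field.
have e2 : s^-1 *: (F |> K |> Lp U |> f) = L0 U |> f.
  have := lb0_LmLp q_gt0 f0; rewrite (LmE q_gt0 f2) => /(congr1 (fun x => s ^+ 2 *: x)).
  rewrite !scalerA mulfV ?expf_neq0 // scale1r => <-.
  rewrite (lactK_lb f2) lactZr scalerA; congr (_ *: _).
  by rewrite -[s ^ (1 - _)]/(s^-1) -[s ^ _]/(s ^+ 2); field.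
rewrite omm_mulr omp_mulr om0_mulr expr2 !lactM qhalfE // -[s ^ (-1)]/(s^-1).
rewrite !scalerAl -!embZ e1 e2 -scaleN1r !lactZr !(lb0_K f3) scaleN1r rmorphN mulNr.
by rewrite addrA addrK addrAC dif_left.
Qed.

(** * The Laplacians *)

Variables (alpha nu m : R) (HL HR : Om -> Om).
Hypotheses (HLP : left_hodge alpha nu m HL) (HRP : right_hodge alpha nu m HR).

Definition box f :=
  (2 * q * alpha)%:C *: (L0 U |> f) + nu%:C *: (L0 U |> L0 U |> f).

Lemma lb_box f : lb 0 f -> lb 0 (- box f).
Proof.
move=> f0; rewrite -scaleN1r; apply/lb_Z/lb_D; apply: lb_Z; first exact: lb_L0.
by do 2 apply: lb_L0 => //.
Qed.

(** The factor m produced by the first Hodge operator is absorbed by the normalised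
    volume form, which the second one sends to 1. *)
Lemma box_volE f : I (- box f) * vol Om m =
  (- (m * (2 * q * alpha)))%:C *: (I (L0 U |> f) * vol0)
  + (- (m * nu))%:C *: (I (L0 U |> L0 U |> f) * vol0).
Proof.
have -> : I (- box f) = - ((2 * q * alpha)%:C *: I (L0 U |> f)
    + nu%:C *: I (L0 U |> L0 U |> f)) by rewrite -!embZ -rmorphD -rmorphN.
rewrite /vol -scalerAr mulNr mulrDl -!scalerAl scalerN -scaleNr scalerDr !scalerA.
by rewrite -!rmorphN -!rmorphM !mulNr.
Qed.

Lemma dif_left_hodge f : lb 0 f -> d (HL (d (I f))) = I (- box f) * vol Om m.
Proof.
move=> f0; rewrite box_volE.
have f1 := lb_Lm q_gt0 f0; have f2 := lb_Lp q_gt0 f0; have f3 := lb_L0 q_gt0 f0.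
have z n : lb n 0 := lb_0 T n.
have sm : sphere_form 1 (I (Lm U |> f) * wm : Om).
  by exists (Lm U |> f), 0, 0; split=> //; rewrite !rmorph0 !mul0r !addr0.
have sp : sphere_form 1 (I (Lp U |> f) * wp : Om).
  by exists 0, (Lp U |> f), 0; split=> //; rewrite !rmorph0 !mul0r addr0 add0r.
have smp : sphere_form 1 (I (Lm U |> f) * wm + I (Lp U |> f) * wp : Om).
  by exists (Lm U |> f), (Lp U |> f), 0; split=> //; rewrite !rmorph0 !mul0r addr0.
have s0 : sphere_form 1 (I (L0 U |> f) * w0 : Om).
  by exists 0, 0, (L0 U |> f); split=> //; rewrite !rmorph0 !mul0r !add0r.
rewrite dif_left // (left_hodge_add HLP (k := 1)) //.
rewrite (left_hodge_add HLP (k := 1)) // (left_hodge_m HLP) // (left_hodge_p HLP) //.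
rewrite (left_hodge_0 HLP) // !linearD !linearZ /= dif_Im0 // dif_I0p // dif_Imp //.
rewrite (lb0_LpLm q_gt0) // (lb0_LmLp q_gt0) //.
have r0 := qroot_neq0 q_gt0.
rewrite !embZ -!scalerAl !scalerN !scalerA -!scaleNr -scalerDl.
congr (_ *: _ + _ *: _).
by rewrite !(rmorphN, rmorphM, rmorphXn, rmorph_nat) /= (qCE q_gt0); field.
Qed.

(** With R_0 f = - L_0 f, the omega_- ^ omega_+ part contributes L_0 R_0 f and,
    through the corrections in wedge_mp_mulr, twice - L_0 R_0 f; the total is
    R_0 R_0 f as for the left operator. *)
Lemma dif_right_hodge f : lb 0 f -> d (HR (d (I f))) = vol Om m * I (- box f).
Proof.
move=> f0.
have -> : vol Om m * I (- box f) = I (- box f) * vol Om m.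
  by rewrite /vol -scalerAl vol0_mulr ?scalerAr //; exact: lb_box.
rewrite box_volE.
have f1 := lb_Lm q_gt0 f0; have f2 := lb_Lp q_gt0 f0; have f3 := lb_L0 q_gt0 f0.
have g3 : lb 0 (- (L0 U |> f)) by rewrite -scaleN1r; apply: lb_Z.
have z n : lb n 0 := lb_0 T n.
have lbKE g : lb (-2) g -> lb 0 (K |> E |> g).
  by move=> /(lb_E q_gt0) g0; rewrite (lb0_K g0).
have lbFK g : lb 2 g -> lb 0 (F |> K |> g).
  by move=> g2; rewrite (lactK_lb g2) lactZr; apply/lb_Z/(lb_F q_gt0 g2).
have smp g h : lb (-2) g -> lb 2 h -> sphere_form 1 (wm * I g + wp * I h : Om).
  move=> g1 h1; exists g, h, (qhalf q (-1) *: ((K |> E |> g) + (F |> K |> h))).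
  split=> //; first by apply/lb_Z/lb_D; [exact: lbKE|exact: lbFK].
  by rewrite omm_mulr omp_mulr addrACA !lactM embZ rmorphD scalerDr mulrDl !scalerAl.
have sm : sphere_form 1 (wm * I (Lm U |> f) : Om).
  by have := smp _ _ f1 (z _); rewrite rmorph0 mulr0 addr0.
have sp : sphere_form 1 (wp * I (Lp U |> f) : Om).
  by have := smp _ _ (z _) f2; rewrite rmorph0 mulr0 add0r.
have s0 : sphere_form 1 (w0 * I (- (L0 U |> f)) : Om).
  exists 0, 0, (- (L0 U |> f)); split=> //.
  by rewrite !rmorph0 !mul0r !add0r om0_mulr expr2 lactM !(lb0_K g3).
rewrite dif_right // (right_hodge_add HRP (k := 1)) //; last exact: smp.
rewrite (right_hodge_add HRP (k := 1)) // (right_hodge_m HRP) // (right_hodge_p HRP) //.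
rewrite (right_hodge_0 HRP) // !linearD !linearZ /=.
rewrite (wedge_m0_mulr f1) (wedge_0p_mulr f2) wedge_mp_mulr // !linearD !linearZ /=.
have h1 := lb_Lm q_gt0 g3; have h2 := lb_Lp q_gt0 g3.
rewrite !(dif_Im0 f1, dif_I0p f2, dif_Imp g3, dif_Im0 h1, dif_I0p h2).
rewrite !(lb0_LpLm q_gt0, lb0_LmLp q_gt0) //.
rewrite lactNr.
have r0 := qroot_neq0 q_gt0.
rewrite -(scaleN1r (L0 U |> L0 U |> f)) !embZ -!scalerAl !scalerN !scalerA.
rewrite -!scaleNr -!scalerDl -[s ^ (0 - 2 + _)]/(s ^- 4) -[s ^ (0 + 2 + _)]/(s ^+ 4).
congr (_ *: _ + _ *: _);
  rewrite !(rmorphN, rmorphM, rmorphXn, rmorph_nat) /= ?(qCE q_gt0); by field.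
Qed.

Lemma left_box f : lb 0 f -> laplacian HL f = I (box f).
Proof.
move=> f0; rewrite /laplacian dif_left_hodge //.
rewrite (left_hodge_3 HLP (lb_box f0)) (left_hodge_vol HLP) mulr1 -rmorphN.
by congr (I _); rewrite opprK.
Qed.

Lemma right_box f : lb 0 f -> laplacian HR f = I (box f).
Proof.
move=> f0; rewrite /laplacian dif_right_hodge //.
rewrite (right_hodge_3 HRP (lb_box f0)) (right_hodge_vol HRP) mul1r -rmorphN.
by congr (I _); rewrite opprK.
Qed.

Lemma lact_quadratic k1 k2 k3 (g1 g2 g3 h1 h2 h3 : U) f :
  (k1 *: (g1 * h1) + k2 *: (g2 * h2) + k3 *: (g3 * h3)) |> f =
  k1 *: (g1 |> h1 |> f) + k2 *: (g2 |> h2 |> f) + k3 *: (g3 |> h3 |> f).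
Proof. by rewrite !(lactDl, lactZl, lactM). Qed.

Lemma left_action f : lb 0 f ->
  lact T (alpha%:C *: (Lp U * Lm U) + (q ^+ 2 * alpha)%:C *: (Lm U * Lp U)
          + nu%:C *: (L0 U * L0 U)) f = box f.
Proof.
move=> f0; have r0 := qroot_neq0 q_gt0.
rewrite lact_quadratic lb0_LpLm // lb0_LmLp // !scalerA -scalerDl.
congr (_ *: _ + _).
by rewrite !(rmorphM, rmorphXn, rmorph_nat) /= (qCE q_gt0); field.
Qed.

Lemma right_action f : lb 0 f ->
  lact T ((q ^+ 2 * alpha)%:C *: (Rp U * Rm U) + alpha%:C *: (Rm U * Rp U)
          + nu%:C *: (R0 U * R0 U)) f = box f.
Proof.
move=> f0; have r0 := qroot_neq0 q_gt0.
have [f1 f2] := (lb_Lm q_gt0 f0, lb_Lp q_gt0 f0).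
have LK g n h : lb n h -> (g * K ^+ 2) |> h = s ^ (n + n) *: (g |> h).
  by move=> hn; rewrite expr2 !lactM !(lactK_lb hn, lactZr) scalerA expfzDr.
rewrite lact_quadratic /R0 !lactNl lactNr opprK /Rm /Rp !(LK _ _ _ f0) !scale1r.
rewrite (LK _ _ _ f1) (LK _ _ _ f2) lb0_LpLm // lb0_LmLp // !scalerA -scalerDl.
congr (_ *: _ + _); rewrite -[s ^ (0 - 2 + _)]/(s ^- 4) -[s ^ (0 + 2 + _)]/(s ^+ 4).
by rewrite !rmorphM rmorph_nat /= (qCE q_gt0); field.
Qed.

Lemma box_phi J l : box (phi0 T J l) = (2 * q * alpha * qnum q J * qnum q J.+1
  + nu * qnum q J ^+ 2 * qnum q J.+1 ^+ 2)%:C *: phi0 T J l.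
Proof.
rewrite /box L0_phi // lactZr L0_phi // !scalerA -scalerDl; congr (_ *: _).
rewrite -!(qnumE q_gt0); move: (qnum q J) (qnum q J.+1) => x y.
by rewrite rmorphD !rmorphM rmorph_nat /=; ring.
Qed.

Lemma lb_phi0 J l : lb 0 (phi0 T J l).
Proof. by apply/lb_ract/lb0_cJa'J. Qed.

End Sphere.

Theorem mainTheorem3 (R : realType) (q : R) (q_gt0 : 0 < q) (q_lt1 : q < 1)
    (A : SUq2 q) (U : Uqsu2 q) (T : Uq_actions A U) (Om : calculus4D T)
    (Gamma : Om -> Om -> R[i]) (alpha eps nu gam : R)
    (Gamma_hr : hermitian_real_contraction Gamma alpha eps nu gam)
    (Gamma_nondeg : alpha != 0)
    (m : R) (HL HR : Om -> Om)
    (HLP : left_hodge alpha nu m HL) (HRP : right_hodge alpha nu m HR) :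
  [/\ forall f : A, line_bundle T 0 f ->
        laplacian HL f =
          emb Om (lact T (alpha%:C *: (Lp U * Lm U)
                           + (q ^+ 2 * alpha)%:C *: (Lm U * Lp U)
                           + nu%:C *: (L0 U * L0 U)) f),
      forall f : A, line_bundle T 0 f ->
        laplacian HR f =
          emb Om (lact T ((q ^+ 2 * alpha)%:C *: (Rp U * Rm U)
                           + alpha%:C *: (Rm U * Rp U)
                           + nu%:C *: (R0 U * R0 U)) f),
      forall f : A, line_bundle T 0 f ->
        laplacian HL f = laplacian HR f /\
        laplacian HR f =
          emb Om (lact T ((2 * q * alpha)%:C *: L0 U
                           + nu%:C *: (L0 U ^+ 2)) f)
    & forall J l : nat, (l <= 2 * J)%N ->
        let phi := phi0 T J l in
        let ev := 2 * q * alpha * qnum q J * qnum q J.+1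
                  + nu * qnum q J ^+ 2 * qnum q J.+1 ^+ 2 in
        [/\ line_bundle T 0 phi,
            laplacian HL phi = laplacian HR phi
          & laplacian HR phi = emb Om (ev%:C *: phi)]].
Proof.
have boxL := left_box q_gt0 q_lt1 HLP; have boxR := right_box q_gt0 q_lt1 HRP.
split=> [f f0|f f0|f f0|J l _ phi ev].
- by rewrite boxL // left_action.
- by rewrite boxR // right_action.
- rewrite boxL // boxR //; split=> //.
  by rewrite lactDl !lactZl expr2 lactM.
have phi_lb : line_bundle T 0 phi by exact: lb_phi0.
by rewrite boxL // boxR // box_phi.
Qed.
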